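(* Let $\mathcal Z$ be a finite zero-set and let $a_0,b_0$ be positive integers with $\mathcal Z\subseteq R_{a_0,b_0}$. Then $$\gamma(\mathcal Z)=\min\{|A|: A\subseteq R_{a_0,b_0},\ A \text{ finite and spans}\}.$$ Equivalently: if $A\subseteq\mathbb Z_+^2$ is finite and spans, there is $B\subseteq R_{a_0,b_0}$ that spans with $|B|\le|A|$.
   Context: Let $\mathbb Z_+=\{0,1,2,\dots\}$ and, for positive integers $a,b$, let $R_{a,b}=([0,a-1]\times[0,b-1])\cap\mathbb Z_+^2$. A (discrete) zero-set is a set $\mathcal Z\subseteq\mathbb Z_+^2$ that is a union of rectangles $R_{a,b}$. For $A\subseteq\mathbb Z_+^2$ and $x\in\mathbb Z_+^2$ let $\mathrm{row}(x,A)$ (resp. $\mathrm{col}(x,A)$) be the number of points of $A$ on the horizontal (resp. vertical) line through $x$. The neighborhood growth transformation is $\mathcal T(A)=A\cup\{x\in\mathbb Z_+^2\setminus A:(\mathrm{row}(x,A),\mathrm{col}(x,A))\notin\mathcal Z\}$. A set $A$ spans if $\bigcup_{t\ge0}\mathcal T^t(A)=\mathbb Z_+^2$. $\gamma(\mathcal Z)$ is the minimum cardinality of a finite spanning set. *)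

(* Defs.v *)
From mathcomp Require Import all_boot.
Set Implicit Arguments. Unset Strict Implicit. Unset Printing Implicit Defensive.

Definition point := (nat * nat)%type.

Definition in_rect (a b : nat) (p : point) : Prop := p.1 < a /\ p.2 < b.

Definition is_zero_set (Z : point -> Prop) : Prop :=
  exists F : nat -> nat -> Prop,
    forall p, Z p <-> exists a b, [/\ F a b, 0 < a, 0 < b & in_rect a b p].

Definition finite_set (Z : point -> Prop) : Prop :=
  exists s : seq point, forall p, Z p -> p \in s.

Definition row_ge (A : point -> Prop) (x : point) (k : nat) : Prop :=
  exists s : seq point, [/\ uniq s, size s = k &
    forall y, y \in s -> A y /\ y.2 = x.2].
Definition col_ge (A : point -> Prop) (x : point) (k : nat) : Prop :=
  exists s : seq point, [/\ uniq s, size s = k &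
    forall y, y \in s -> A y /\ y.1 = x.1].

(* row(x,A) = k  (a finite value); infinite counts are never equal to any k *)
Definition row_eq A x k := row_ge A x k /\ ~ row_ge A x k.+1.
Definition col_eq A x k := col_ge A x k /\ ~ col_ge A x k.+1.

(* (row(x,A), col(x,A)) \in Z ; a pair with an infinite entry is not in Z *)
Definition rowcol_in (Z A : point -> Prop) (x : point) : Prop :=
  exists r c, [/\ row_eq A x r, col_eq A x c & Z (r, c)].

Definition T (Z A : point -> Prop) : point -> Prop :=
  fun x => A x \/ (~ A x /\ ~ rowcol_in Z A x).

Fixpoint iterT (Z : point -> Prop) (t : nat) (A : point -> Prop) : point -> Prop :=
  match t with
  | 0 => A
  | t'.+1 => T Z (iterT Z t' A)
  end.

Definition spans (Z A : point -> Prop) : Prop :=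
  forall x : point, exists t, iterT Z t A x.

Definition setof (s : seq point) : point -> Prop := fun p => p \in s.
Definition ncard (s : seq point) : nat := size (undup s).

Definition is_min (P : nat -> Prop) (n : nat) : Prop :=
  P n /\ forall m, P m -> n <= m.

(* Main.v *)
Require Import Defs.
From mathcomp Require Import all_boot perm boolp.

(* On a finite grid containing the initial set [A] and at least the rectangle
   [a x b], spanning the plane amounts to filling the grid, so it is enough to
   delete one column [m] of a grid with more than [a] columns, then to transpose.

   Slow the growth down: column [m] joins a row only once that row is complete,
   that is, has [a] points.  Let [S] be the set so generated.  If no column of
   [S] is smaller than [m], then [S] is closed under the original growth: a row
   ready to be joined by [m] is ready to be joined by all columns, hence
   complete.  Otherwise the smallest column [x0] of [S], like [m], consists of
   initial points and points of complete rows only; exchanging the columns [x0]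
   and [m] of [A] in the incomplete rows keeps the size of [A] and the spanning
   property, and decreases the number of initial points of [m] in incomplete
   rows.  So eventually the slowed growth fills the grid.  Each initial point of
   [m] can then be moved, within its row, to the place of that row which is
   filled last, and [m] becomes empty and useless. *)

Set Implicit Arguments. Unset Strict Implicit. Unset Printing Implicit Defensive.

(** * Growth on a finite grid *)

Section Grid.
Variables (X Y : finType).
Implicit Types (A S E : X -> Y -> bool).

Definition row S y := #|[set x | S x y]|.
Definition col S x := #|[set y | S x y]|.
Definition gsize S := \sum_y row S y.
Definition gsub A S := forall x y, A x y -> S x y.

Lemma row_sub A S y : (forall x, A x y -> S x y) -> row A y <= row S y.
Proof. by move=> h; apply/subset_leq_card/subsetP=> x; rewrite !inE; apply: h. Qed.

Lemma col_sub A S x : (forall y, A x y -> S x y) -> col A x <= col S x.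
Proof. by move=> h; apply/subset_leq_card/subsetP=> y; rewrite !inE; apply: h. Qed.

Lemma row_perm S (s : {perm X}) y : row (fun x => S (s x)) y = row S y.
Proof.
rewrite /row -[RHS](card_preimset _ (@perm_inj _ s)).
by apply: eq_card => x; rewrite !inE.
Qed.

Lemma gsizeE S : gsize S = \sum_y \sum_x S x y.
Proof.
apply: eq_bigr => y _; rewrite /row -sum1_card big_mkcond /=.
by apply: eq_bigr => x _; rewrite inE; case: S.
Qed.

Variable z : nat -> nat -> bool.

Definition gclosed S := forall x y, ~~ z (row S y) (col S x) -> S x y.
(** For downward closed [z] the set grown from [A] is the least closed superset of [A], so closed
    supersets can replace iteration. *)
Definition gspans A := forall S, gsub A S -> gclosed S -> forall x y, S x y.

(** * Growth slowed down at one column *)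

Section Frozen.
Variables (a : nat) (m : X).
Hypothesis z_down :
  forall r c r' c', r' <= r -> c' <= c -> z r c -> z r' c'.
Hypothesis z_row : forall r c, z r c -> r < a.
Hypothesis a_lt : a < #|X|.

Lemma zN_mono r c r' c' : r <= r' -> c <= c' -> ~~ z r c -> ~~ z r' c'.
Proof. by move=> hr hc; apply: contra; apply: z_down. Qed.

Lemma zN_row r c : a <= r -> ~~ z r c.
Proof. by move=> h; apply/negP=> /z_row; rewrite ltnNge h. Qed.

(* Growth slowed down at column [m], which joins a row only once that row has
   [a] points, and at the banned points [E], which never join. *)
Definition frule E S x y :=
  if x == m then a <= row S y
  else ~~ E x y && ~~ z (row S y) (col S x).

Definition fclosed E S := forall x y, frule E S x y -> S x y.

Definition fgen E A x y := `[< forall S, gsub A S -> fclosed E S -> S x y >].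

Definition ban0 : X -> Y -> bool := fun _ _ => false.

Lemma frule_mono E S S' x y : gsub S S' -> frule E S x y -> frule E S' x y.
Proof.
move=> h; rewrite /frule; have hr: row S y <= row S' y by apply: row_sub => ?; apply: h.
case: ifP => _; first by move/leq_trans; apply.
case/andP=> -> /=; apply: zN_mono => //; apply: col_sub => ?; exact: h.
Qed.

Lemma fgen_least E A S : gsub A S -> fclosed E S -> gsub (fgen E A) S.
Proof. by move=> h1 h2 x y /asboolP; apply. Qed.

Lemma fgen_sub E A : gsub A (fgen E A).
Proof. by move=> x y h; apply/asboolP=> S hS _; apply: hS. Qed.

Lemma fgen_closed E A : fclosed E (fgen E A).
Proof.
move=> x y h; apply/asboolP=> S hA hS; apply: (hS).
by apply: frule_mono h; apply: fgen_least.
Qed.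

Lemma gclosed_fclosed S : gclosed S -> fclosed ban0 S.
Proof.
move=> h x y; rewrite /frule; case: ifP => _; last exact: h.
by move=> ha; apply: h; apply: zN_row.
Qed.

Lemma fclosed_complete S x y : fclosed ban0 S -> a <= row S y -> S x y.
Proof.
move=> h ha; apply: h; rewrite /frule; case: ifP => _ //=; exact: zN_row.
Qed.

Lemma row_but_m S y : (forall x, x != m -> S x y) -> a <= row S y.
Proof.
move=> h; rewrite -ltnS (leq_trans a_lt) // (cardD1 m) inE /= -add1n leq_add2l.
by apply/subset_leq_card/subsetP=> x; rewrite !inE andbT; apply: h.
Qed.

(** * Exchange of two columns in the incomplete rows *)

Section Swap.
Variable A : X -> Y -> bool.
Let S := fgen ban0 A.
Variable x0 : X.
Hypothesis x0_min : forall x, col S x0 <= col S x.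

Let complete y := a <= row S y.

Lemma S_complete x y : complete y -> S x y.
Proof. exact/fclosed_complete/fgen_closed. Qed.

(* A point of column [x0] gained in row [y] would, by minimality of [x0],
   be gained by every other column too. *)
Lemma pure_min x y : (x == x0) || (x == m) -> S x y -> A x y || complete y.
Proof.
pose S' x y := S x y && ((x == x0) || (x == m) ==> A x y || complete y).
have hS' : gsub S' S by move=> ? ? /andP[].
suff h : gsub S S' by move=> hx /h /andP[_]; rewrite hx.
apply: fgen_least => [u v hA|u v hr].
  by rewrite /S' hA implybT andbT; apply: fgen_sub.
have hr' := frule_mono hS' hr.
have hSu : S u v by apply: fgen_closed.
rewrite /S' hSu /=; apply/implyP=> hu; apply/orP; right.
move: hr'; rewrite /frule; have [//|hm /= hz] := eqVneq u m.
have /eqP uE : u == x0 by rewrite (negPf hm) orbF in hu.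
apply: row_but_m => w hw; apply: fgen_closed; rewrite /frule (negPf hw) /=.
by apply: zN_mono hz => //; rewrite uE.
Qed.

Lemma fgen_gclosed : x0 = m -> gclosed S.
Proof.
move=> e x y hz; have [xm|hx] := eqVneq x m; last first.
  by apply: fgen_closed; rewrite /frule (negPf hx).
apply/S_complete/row_but_m => w hw; apply: fgen_closed.
rewrite /frule (negPf hw) /=; apply: zN_mono (leqnn _) _ hz.
by rewrite xm -{1}e.
Qed.

Hypothesis x0_lt : col S x0 < col S m.

Let s := tperm x0 m.

Definition swapped x y := if complete y then A x y else A (s x) y.

Lemma gsize_swapped : gsize swapped = gsize A.
Proof.
apply: eq_bigr => y _; rewrite -[RHS](row_perm A (if complete y then 1%g else s)).
by apply: eq_card => x; rewrite !inE /swapped; case: ifP => _ //; rewrite perm1.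
Qed.

Definition gap x := #|[set y | A x y & ~~ complete y]|.

(** Complete rows contribute equally to [x0] and [m], and by [pure_min] the other rows contribute
    initial points only. *)
Lemma colE x : (x == x0) || (x == m) -> col S x = #|[set y | complete y]| + gap x.
Proof.
move=> hx; rewrite /col -(cardsID [set y | complete y]); congr (_ + _).
  apply: eq_card => y; rewrite !inE andbC.
  by case h: (complete y) => //=; rewrite S_complete.
apply: eq_card => y; rewrite !inE; case h: (complete y) => /=; rewrite ?andbF ?andbT //.
apply/idP/idP => [/(pure_min hx)|]; last exact: fgen_sub.
by rewrite h orbF.
Qed.

Lemma gap_lt : gap x0 < gap m.
Proof. by move: x0_lt; rewrite !colE ?eqxx ?orbT // ltn_add2l. Qed.

(** The growth from [A] is followed together with its image in [S0], mirrored in incomplete rows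
    only. Mirroring preserves row counts, and column counts matter only off [m], so [x0] is the one
    delicate column. *)
Lemma swapped_gen S0 :
  gsub swapped S0 -> fclosed ban0 S0 -> gsub (fun x => S (s x)) S0.
Proof.
move=> hA h0.
pose S1 x y := S x y && S0 (if complete y then x else s x) y.
have hS1 : gsub S1 S by move=> ? ? /andP[].
have hrow y : row S1 y <= row S0 y.
  rewrite -(row_perm S0 (if complete y then 1%g else s)).
  by apply: row_sub => x /andP[_]; case: ifP => _ //; rewrite perm1.
have hcol x : x != m -> col S1 x <= col S0 x.
  move=> hm; have [->|hx] := eqVneq x x0; last first.
    by apply: col_sub => y /andP[_]; rewrite /s tpermD 1?eq_sym ?if_same.
  rewrite /col -(cardsID [set y | complete y]).
  rewrite -[leqRHS](cardsID [set y | complete y]); apply: leq_add.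
    apply/subset_leq_card/subsetP=> y; rewrite !inE /S1.
    by case: (complete y); rewrite ?andbF //= => /andP[/andP[_ ->]].
  (* In incomplete rows [x0] holds only its initial points, fewer than those of [m], which [swapped]
     has put into column [x0]. *)
  apply: leq_trans (leq_trans (ltnW gap_lt) _).
    apply/subset_leq_card/subsetP=> y; rewrite !inE.
    case/andP=> hc /hS1 /pure_min; rewrite eqxx (negPf hc) orbF andbT; exact.
  apply/subset_leq_card/subsetP=> y; rewrite !inE => /andP[hy hc].
  by rewrite hc /=; apply: hA; rewrite /swapped (negPf hc) /s tpermL.
have hS : gsub S S1.
  apply: fgen_least => [x y hx|x y hr].
    have hSx : S x y by apply: fgen_sub.
    rewrite /S1 hSx /=; apply: hA; rewrite /swapped.
    by case: (complete y); rewrite ?tpermK.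
  have hSx : S x y by apply: fgen_closed (frule_mono hS1 hr).
  rewrite /S1 hSx /=; move: hr; rewrite /frule.
  have [-> ha|hm /= hz] := eqVneq x m.
    have -> : complete y by apply: leq_trans ha (row_sub _) => ?; apply: hS1.
    exact/(fclosed_complete _ h0)/(leq_trans ha).
  have h0x : S0 x y.
    apply: h0; rewrite /frule (negPf hm) /=; exact: zN_mono (hrow y) (hcol x hm) hz.
  case: ifP => // hc; have [e|hx] := eqVneq x x0; last by rewrite /s tpermD 1?eq_sym.
  apply: hA; rewrite /swapped hc tpermK.
  have hp : (x == x0) || (x == m) by rewrite e eqxx.
  by have := pure_min hp hSx; rewrite hc orbF.
move=> x y /= hx; case hc: (complete y); last by have /andP[_] := hS _ _ hx; rewrite hc tpermK.
have /hS/andP[_] : S x y by apply: S_complete.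
by rewrite hc.
Qed.

Lemma gspans_swapped : gspans A -> gspans swapped.
Proof.
move=> hA S0 h0 hc x y.
have hs := swapped_gen h0 (gclosed_fclosed hc).
suff h u v : S0 (s u) v by rewrite -(tpermK x0 m x).
(* Exchanging two whole columns of [S0] preserves closedness, and the result contains [A]. *)
apply: (hA (fun u => S0 (s u))) => [{}u {}v hu|{}u {}v hz].
  by apply: hs; rewrite tpermK; apply: fgen_sub.
apply: hc; move: hz; rewrite row_perm; congr (~~ z _ _).
Qed.

(** Complete rows stay complete after the exchange, so the points counted come from column [x0] in
    incomplete rows. *)
Lemma gap_swapped :
  #|[set y | swapped m y & row (fgen ban0 swapped) y < a]| < gap m.
Proof.
apply: leq_ltn_trans gap_lt; apply/subset_leq_card/subsetP=> y; rewrite !inE.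
case/andP=> h1 h2.
have hc : ~~ complete y.
  rewrite -ltnNge; apply: leq_ltn_trans h2; rewrite -(row_perm S s).
  apply: row_sub => x; apply: swapped_gen; [exact: fgen_sub|exact: fgen_closed].
by rewrite hc andbT; move: h1; rewrite /swapped (negPf hc) /s tpermR.
Qed.

End Swap.

Definition fspans A := forall x y, fgen ban0 A x y.

Lemma gspans_fspans A : gspans A ->
  exists2 A', gsize A' = gsize A & fspans A'.
Proof.
have [n] := ubnP #|[set y | A m y & row (fgen ban0 A) y < a]|.
elim: n A => // n IH A hn hA.
have [x0 _ hx0] := @arg_minnP X m predT (col (fgen ban0 A)) isT.
have {}hx0 x : col (fgen ban0 A) x0 <= col (fgen ban0 A) x by apply: hx0.
have [hm|hm] := leqP (col (fgen ban0 A) m) (col (fgen ban0 A) x0).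
  exists A => //; apply: hA; first exact: fgen_sub.
  by apply: (@fgen_gclosed _ m) => // x; apply: leq_trans hm _.
have [|h|A' h1 h2] := IH (swapped A x0).
- rewrite -ltnS; apply: leq_trans hn; rewrite ltnS.
  apply: leq_trans (gap_swapped hx0 hm) _.
  by rewrite /gap; apply/subset_leq_card/subsetP=> y; rewrite !inE -ltnNge.
- exact: gspans_swapped.
by exists A' => //; rewrite h1 gsize_swapped.
Qed.

(** * Emptying column [m] *)

Lemma fgen_banned E A x y : x != m -> E x y -> fgen E A x y -> A x y.
Proof.
pose S' x y := fgen E A x y && ((x != m) && E x y ==> A x y).
have hS' : gsub S' (fgen E A) by move=> ? ? /andP[].
suff h : gsub (fgen E A) S' by move=> hx hE /h /andP[_]; rewrite hx hE.
apply: fgen_least => [u v hA|u v hr].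
  by rewrite /S' hA implybT andbT; apply: fgen_sub.
rewrite /S' (fgen_closed (frule_mono hS' hr)) /=.
by move: hr; rewrite /frule; case: (u == m) => //= /andP[/negPf->].
Qed.

Lemma fgen_ban_sub E E' A :
  gsub E' E -> gsub (fgen E A) (fgen E' A).
Proof.
move=> h; apply: fgen_least; first exact: fgen_sub.
move=> x y hr; apply: fgen_closed; move: hr; rewrite /frule; case: ifP => // _.
case/andP=> hE ->; rewrite andbT; exact: contra (@h x y) hE.
Qed.

Lemma fspans_sub A S : fspans A -> gsub A S -> fclosed ban0 S -> forall x y, S x y.
Proof. by move=> hA h1 h2 x y; apply: (fgen_least h1 h2); apply: hA. Qed.

Definition ban (y0 : Y) (E : {set X}) x y := (y == y0) && (x \in E).

(* Lift the ban on row [y0] one infectable point at a time: the point that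
   remains is the last one of that row to be gained. *)
Lemma last_gained A y0 : fspans A -> A m y0 -> (exists x, ~~ A x y0) ->
  exists2 x', ~~ A x' y0 &
    forall x, x != x' -> fgen (ban y0 [set x']) A x y0.
Proof.
move=> hA hm hex.
(* Here [E] is the set of places of row [y0] still banned; the rest of the row must be gained in
   spite of the ban. *)
pose good (E : {set X}) := [/\ E != set0, forall x, x \in E -> ~~ A x y0
  & forall x, x \notin E -> fgen (ban y0 E) A x y0].
suff main n (E : {set X}) : #|E| <= n -> good E -> exists x', good [set x'].
  case: (main #|X| [set x | ~~ A x y0]).
  - exact: max_card.
  - split=> [|x|x]; rewrite ?inE ?negbK //; last exact: fgen_sub.
    by case: hex => x hx; apply/set0Pn; exists x; rewrite inE.
  move=> x' [_ h1 h2]; exists x'; first by apply: h1; rewrite inE.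
  by move=> x hx; apply: h2; rewrite inE.
elim: n E => [|n IH] E hn [h0 h1 h2].
  by move: h0; rewrite -card_gt0 ltnNge hn.
have [hle|hgt] := leqP #|E| 1.
  have /cards1P[x' e] : #|E| == 1 by rewrite eqn_leq hle card_gt0.
  by exists x'; rewrite -e.
pose S := fgen (ban y0 E) A.
have hEm x : x \in E -> x != m by move/h1; apply: contraNneq => ->.
(* Were no banned place ready to join, [S] would be closed without the ban, hence full, though
   banned places are never gained. *)
have [x1 hx1 hr] : exists2 x1, x1 \in E & frule ban0 S x1 y0.
  apply: contrapT => hno; have /set0Pn[x hx] := h0.
  have : S x y0.
    apply: (fspans_sub hA); first exact: fgen_sub.
    move=> u v hr; have [huv|huv] := boolP (ban y0 E u v).
      by case/andP: huv => /eqP vE hu; case: hno; exists u => //; rewrite -vE.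
    apply: fgen_closed; move: hr; rewrite /frule; case: ifP => // _.
    by rewrite huv.
  move=> h; case/negP: (h1 _ hx); apply: (fgen_banned (hEm _ hx) _ h).
  by rewrite /ban eqxx.
have hsub : gsub S (fgen (ban y0 (E :\ x1)) A).
  by apply: fgen_ban_sub => u v; rewrite /ban !inE => /andP[->/andP[]].
apply: (IH (E :\ x1)).
  by move: hn; rewrite (cardsD1 x1) hx1.
split=> [|x|x].
- by rewrite -card_gt0; move: hgt; rewrite (cardsD1 x1) hx1.
- by rewrite !inE => /andP[_]; apply: h1.
- rewrite !inE negb_and negbK => /orP[/eqP->|/h2]; last exact: hsub.
  apply: fgen_closed; have := frule_mono hsub hr; rewrite /frule.
  by case: ifP => // _; rewrite /ban !inE !eqxx.
Qed.

Lemma fspans_move A y0 : fspans A -> A m y0 ->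
  exists A', [/\ gsize A' <= gsize A, fspans A' &
    #|[set y | A' m y]| < #|[set y | A m y]|].
Proof.
move=> hA hm.
have hcard A' : (forall y, A' m y -> A m y) -> ~~ A' m y0 ->
    #|[set y | A' m y]| < #|[set y | A m y]|.
  move=> h1 h2; apply/proper_card/properP; split.
    by apply/subsetP=> y; rewrite !inE; apply: h1.
  by exists y0; rewrite inE.
(* If the rest of the row is initial, the row is complete without [m] and the point is simply
   deleted. *)
have [hall|hex] := pselect (forall x, x != m -> A x y0).
  pose A' x y := A x y && ~~ ((x == m) && (y == y0)).
  exists A'; split.
  - by apply: leq_sum => y _; apply: row_sub => x /andP[].
  - apply: (fspans_sub hA); last exact: fgen_closed.
    move=> x y hxy; case hxm: ((x == m) && (y == y0)).
      case/andP: hxm => /eqP-> /eqP->.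
      apply: fclosed_complete; first exact: fgen_closed.
      apply: row_but_m => w hw; apply: fgen_sub.
      by rewrite /A' (negPf hw) andbT hall.
    by apply: fgen_sub; rewrite /A' hxy hxm.
  - by apply: hcard => [y /andP[]//|]; rewrite /A' !eqxx andbF.
have [x' hx' hlast] : exists2 x', ~~ A x' y0 &
    forall x, x != x' -> fgen (ban y0 [set x']) A x y0.
  apply: last_gained => //; apply: contrapT => hno; apply: hex => x _.
  by apply/negPn/negP=> hx; apply: hno; exists x.
have hx'm : x' != m by apply: contraNneq hx' => ->.
pose s := tperm x' m.
pose A' x y := A (if y == y0 then s x else x) y.
exists A'; split.
- apply: leq_sum => y _; rewrite -[leqRHS](row_perm A (if y == y0 then s else 1%g)).
  by apply: row_sub => x; rewrite /A'; case: ifP => // _; rewrite perm1.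
- pose S0 := fgen ban0 A'.
  pose B := fgen (ban y0 [set x']) A.
  have S0x' : S0 x' y0 by apply: fgen_sub; rewrite /A' eqxx /s tpermL.
  have hBx' : ~~ B x' y0.
    apply: contra hx' => h; apply: (fgen_banned hx'm _ h).
    by rewrite /ban eqxx inE eqxx.
  have hA0 x y : A x y -> S0 x y || ((x == m) && (y == y0)).
    move=> hxy; have [//|hxm] := boolP ((x == m) && (y == y0)); first by rewrite orbT.
    rewrite orbF; apply: fgen_sub; rewrite /A'; case: eqP => // yE; subst y.
    rewrite /s tpermD //; last by rewrite eq_sym; move: hxm; rewrite eqxx andbT.
    by apply: contraNneq hx' => ->.
  (* The growth [B] stays in [S0], except perhaps at [(m, y0)]. In row [y0] the place [x'], absent
     from [B] but present in [S0], makes up for [m] in the count. *)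
  pose S1 x y := B x y && (S0 x y || ((x == m) && (y == y0))).
  have hS1 : gsub S1 B by move=> ? ? /andP[].
  have hrow y : row S1 y <= row S0 y.
    rewrite -(row_perm S0 (if y == y0 then s else 1%g)).
    apply: row_sub => x; rewrite /S1; have [->|_] := eqVneq y y0; last first.
      by rewrite andbF orbF perm1 => /andP[].
    have [->|hxm] := eqVneq x m; first by rewrite /s tpermR.
    have [->|hxx] := eqVneq x x'; first by rewrite (negPf hBx').
    by rewrite /s tpermD 1?eq_sym // orbF => /andP[].
  have hcol x : x != m -> col S1 x <= col S0 x.
    by move=> hxm; apply: col_sub => y; rewrite /S1 (negPf hxm) orbF => /andP[].
  have hB : gsub B S1.
    apply: fgen_least => [x y hxy|x y hr].
      by rewrite /S1 hA0 // andbT; apply: fgen_sub.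
    have hBx : B x y by apply: fgen_closed (frule_mono hS1 hr).
    rewrite /S1 hBx /=; apply/orP; left.
    apply: fgen_closed; move: hr; rewrite /frule.
    case: eqVneq => [_ ha|hxm]; first exact: leq_trans (hrow y).
    by case/andP=> _ /=; apply: zN_mono; [apply: hrow|apply: hcol].
  have hm0 : S0 m y0.
    apply: fclosed_complete; first exact: fgen_closed.
    apply: row_but_m => x hx; have [->//|hxx] := eqVneq x x'.
    by have /hB/andP[_] := hlast x hxx; rewrite (negPf hx) orbF.
  apply: (fspans_sub hA); last exact: fgen_closed.
  by move=> x y /hA0 /orP[//|/andP[/eqP-> /eqP->]].
- apply: hcard => [y|]; rewrite /A' ?eqxx /s ?tpermR //.
  by case: eqP => // ->.
Qed.

Lemma fspans_empty A : fspans A ->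
  exists A', [/\ gsize A' <= gsize A, fspans A' & forall y, ~~ A' m y].
Proof.
have [n] := ubnP #|[set y | A m y]|; elim: n A => // n IH A hn hA.
have [[y0 hy]|hno] := pselect (exists y, A m y); last first.
  by exists A; split=> // y; apply/negP=> hy; apply: hno; exists y.
have [A1 [h1 h2 h3]] := fspans_move hA hy.
have [|A' [h4 h5 h6]] := IH A1 _ h2; first exact: leq_trans h3 _.
by exists A'; split=> //; apply: leq_trans h1.
Qed.

End Frozen.
End Grid.

Lemma gspans_tr (X Y : finType) z (A : X -> Y -> bool) :
  gspans z A -> gspans (fun r c => z c r) (fun y x => A x y).
Proof.
move=> hA S h1 h2 y x.
by apply: (hA (fun x y => S y x)) => ? ?; [apply: h1|apply: h2].
Qed.

Lemma gsize_card (X Y : finType) (A : X -> Y -> bool) :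
  gsize A = #|[set u : X * Y | A u.1 u.2]|.
Proof.
rewrite gsizeE exchange_big pair_bigA /= -sum1_card [RHS]big_mkcond /=.
by apply: eq_bigr => u _; rewrite inE; case: A.
Qed.

Lemma gsize_tr (X Y : finType) (A : X -> Y -> bool) :
  gsize (fun y x => A x y) = gsize A.
Proof. by rewrite !gsizeE exchange_big. Qed.

Section Reduce.
Variables (z : nat -> nat -> bool) (a : nat) (Y : finType).
Hypothesis z_down :
  forall r c r' c', r' <= r -> c' <= c -> z r c -> z r' c'.
Hypothesis z_row : forall r c, z r c -> r < a.

(** Once emptied, the last column joins only rows with [a] points, where every point is gained
    without its help. *)
Lemma remove_column n (A : 'I_n.+1 -> Y -> bool) : a <= n -> gspans z A ->
  exists2 B : 'I_n -> Y -> bool, gsize B <= gsize A & gspans z B.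
Proof.
move=> an hA; have a_lt : a < #|'I_n.+1| by rewrite card_ord ltnS.
have [A1 e1 h1] := gspans_fspans ord_max z_down z_row a_lt hA.
have [A2 [e2 h2 h3]] := fspans_empty z_down z_row a_lt h1.
exists (fun x => A2 (lift ord_max x)).
  rewrite -e1; apply: leq_trans e2; apply: leq_sum => y _.
  rewrite /row -(card_imset _ (@lift_inj _ ord_max)).
  by apply/subset_leq_card/subsetP=> _ /imsetP[x hx ->]; move: hx; rewrite !inE.
move=> S0 hs hc.
(* Putting the last column back exactly in the rows with [a] points makes the set closed under
   slowed growth. *)
pose S x y := if unlift ord_max x is Some x1 then S0 x1 y else a <= row S0 y.
suff h x y : S x y by move=> x y; have := h (lift ord_max x) y; rewrite /S liftK.
have hrow v : row S0 v < a -> row S v <= row S0 v.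
  move=> ha; rewrite /row; apply: leq_trans (leq_imset_card (lift ord_max) _).
  apply/subset_leq_card/subsetP=> u; rewrite inE /S.
  case: unliftP => [u1 ->|_]; last by rewrite leqNgt ha.
  by move=> hu; apply: imset_f; rewrite inE.
apply: (fspans_sub h2) => [{}x {}y|{}x {}y].
  rewrite /S; case: unliftP => [x1 ->|->]; first exact: hs.
  by rewrite (negPf (h3 y)).
rewrite /frule /S; case: unliftP => [x1 ->|->].
  rewrite eq_sym (negPf (neq_lift _ _)) /= => hz; apply: hc.
  have [ha|ha] := leqP a (row S0 y); first exact: (zN_row z_row).
  apply: (zN_mono z_down _ _ hz); first exact: hrow.
  by apply/subset_leq_card/subsetP=> v; rewrite !inE liftK.
rewrite eqxx; have [//|ha] := leqP a (row S0 y).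
by move=> ha'; have := leq_ltn_trans (leq_trans ha' (hrow _ ha)) ha; rewrite ltnn.
Qed.

Lemma remove_columns n (A : 'I_n -> Y -> bool) : a <= n -> gspans z A ->
  exists2 B : 'I_a -> Y -> bool, gsize B <= gsize A & gspans z B.
Proof.
elim: n A => [|n IH] A; first by rewrite leqn0 => /eqP e; subst a; exists A.
rewrite leq_eqVlt => /orP[/eqP e|]; first by subst a; exists A.
rewrite ltnS => an /(remove_column an)[B hB1 /(IH _ an)[C hC1 hC2]].
by exists C => //; apply: leq_trans hB1.
Qed.

End Reduce.

(** * Passage between the plane and a grid *)

Lemma exact_count (P : nat -> Prop) r : P 0 -> ~ P r.+1 ->
  exists r', [/\ r' <= r, P r' & ~ P r'.+1].
Proof.
move=> h0; elim: r => [|r IH] h; first by exists 0.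
have [hr|hr] := pselect (P r.+1); first by exists r.+1.
by have [r' [h1 h2 h3]] := IH hr; exists r'; split=> //; apply: leqW.
Qed.

Section Plane.
Variables (Z : point -> Prop).
Hypothesis Z_down :
  forall r c r' c', r' <= r -> c' <= c -> Z (r, c) -> Z (r', c').

Lemma T_gain S u :
  (forall r c, Z (r, c) -> row_ge S u r.+1 \/ col_ge S u c.+1) -> T Z S u.
Proof.
move=> h; have [hu|hu] := pselect (S u); [by left|right; split=> //].
by case=> r [c [[_ hr] [_ hc] /h[]]].
Qed.

Lemma iterT_mono t t' A u : t <= t' -> iterT Z t A u -> iterT Z t' A u.
Proof.
move=> /subnK<- h; elim: (t' - t) => //= n IH; by left.
Qed.

(** Counts in [S] are at most those in [S'], so [exact_count] gives them exact values not above [r]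
    and [c], a pair in [Z] by [Z_down]. *)
Lemma T_lost S S' u : (forall v, S v -> S' v) -> T Z S u -> ~ S' u ->
  forall r c, Z (r, c) -> ~ row_ge S' u r.+1 -> ~ col_ge S' u c.+1 -> False.
Proof.
move=> hsub [hu|[_ hT]] hu' r c hZ hr hc; first by apply/hu'/hsub.
have row0 : row_ge S u 0 by exists [::].
have col0 : col_ge S u 0 by exists [::].
have [|r' [hr1 hr2 hr3]] := exact_count (r := r) row0.
  by move=> [s [s1 s2 s3]]; apply: hr; exists s; split=> // y /s3[/hsub].
have [|c' [hc1 hc2 hc3]] := exact_count (r := c) col0.
  by move=> [s [s1 s2 s3]]; apply: hc; exists s; split=> // y /s3[/hsub].
by apply: hT; exists r', c'; split=> //; apply: Z_down hZ.
Qed.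

Let z r c := `[< Z (r, c) >].

Definition restrict p q (P : point -> Prop) (x : 'I_p) (y : 'I_q) : bool :=
  `[< P (val x, val y) >].

(* The extension of [S] to the plane: a point outside the grid belongs to it
   when the part of the grid on its row or column lies in [S]. *)
Definition extend p q (S : 'I_p -> 'I_q -> bool) (u : point) : Prop :=
  forall (x : 'I_p) (y : 'I_q),
    (u.1 < p -> val x = u.1) -> (u.2 < q -> val y = u.2) -> S x y.

(** A point of the extension on this row beyond the columns of the grid would force [S x y]. *)
Lemma extend_row_ge p q (S : 'I_p -> 'I_q -> bool) u x y k :
  (u.2 < q -> val y = u.2) -> ~~ S x y -> row_ge (extend S) u k -> k <= row S y.
Proof.
move=> hy hS [s [s1 <- s3]].
rewrite /row cardE -(size_map val) -(size_map fst); apply: uniq_leq_size.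
  rewrite map_inj_in_uniq // => -[v1 v2] [w1 w2] /s3[_ /= ->] /s3[_ /= ->] /=.
  by move=> ->.
move=> _ /mapP[v /s3[hv e] ->].
have hv2 : v.2 < q -> val y = v.2 by rewrite e.
have hv1 : v.1 < p.
  by rewrite ltnNge; apply/negP=> hp; case/negP: hS; apply: hv => //; rewrite ltnNge hp.
apply/mapP; exists (Ordinal hv1) => //; rewrite mem_enum inE; exact: hv.
Qed.

Lemma extend_col_ge p q (S : 'I_p -> 'I_q -> bool) u x y k :
  (u.1 < p -> val x = u.1) -> ~~ S x y -> col_ge (extend S) u k -> k <= col S x.
Proof.
move=> hx hS [s [s1 <- s3]].
rewrite /col cardE -(size_map val) -(size_map snd); apply: uniq_leq_size.
  rewrite map_inj_in_uniq // => -[v1 v2] [w1 w2] /s3[_ /= ->] /s3[_ /= ->] /=.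
  by move=> ->.
move=> _ /mapP[v /s3[hv e] ->].
have hv1 : v.1 < p -> val x = v.1 by rewrite e.
have hv2 : v.2 < q.
  by rewrite ltnNge; apply/negP=> hp; case/negP: hS; apply: hv => //; rewrite ltnNge hp.
apply/mapP; exists (Ordinal hv2) => //; rewrite mem_enum inE; exact: hv.
Qed.

Lemma spans_gspans p q (A : point -> Prop) :
  (forall u, A u -> in_rect p q u) -> spans Z A -> gspans z (restrict (p := p) (q := q) A).
Proof.
move=> hA hs S hsub hc x y; apply: contrapT => /negP hxy.
have hext u : A u -> extend S u.
  move=> hu x1 y1; have [h1 h2] := hA _ hu => /(_ h1) e1 /(_ h2) e2.
  by apply: hsub; apply/asboolP; rewrite e1 e2 -surjective_pairing.
have hit t : forall u, iterT Z t A u -> extend S u.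
  elim: t => [//|t IH] u hu; apply: contrapT => hn.
  (* The counts of the extension at [u] are at most those of [S] at this grid point, a pair in [Z],
     so [u] cannot be gained. *)
  have [x1 [y1 [e1 e2 hn1]]] : exists x1 y1, [/\ u.1 < p -> val x1 = u.1,
      u.2 < q -> val y1 = u.2 & ~~ S x1 y1].
    apply: contrapT => hno; apply: hn => x1 y1 e1 e2; apply/negPn/negP=> hn1.
    by apply: hno; exists x1, y1.
  have hZ : Z (row S y1, col S x1).
    by apply/asboolP/negPn; apply: contra hn1; apply: hc.
  apply: (T_lost IH hu hn hZ).
    by move/(extend_row_ge e2 hn1); rewrite ltnn.
  by move/(extend_col_ge e1 hn1); rewrite ltnn.
have [t /hit ht] := hs (val x, val y).
by case/negP: hxy; apply: ht.
Qed.

Lemma row_geI p (R : pred 'I_p) P u k :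
  (forall x, R x -> P (val x, u.2)) -> k <= #|[set x | R x]| -> row_ge P u k.
Proof.
move=> h hk; exists (take k [seq (val x, u.2) | x <- enum [set x | R x]]); split.
- by rewrite take_uniq // map_inj_uniq ?enum_uniq // => x y [/val_inj].
- by rewrite size_takel // size_map -cardE.
- by move=> v /mem_take /mapP[x]; rewrite mem_enum inE => hx ->; split; first exact: h.
Qed.

Lemma col_geI q (R : pred 'I_q) P u k :
  (forall y, R y -> P (u.1, val y)) -> k <= #|[set y | R y]| -> col_ge P u k.
Proof.
move=> h hk; exists (take k [seq (u.1, val y) | y <- enum [set y | R y]]); split.
- by rewrite take_uniq // map_inj_uniq ?enum_uniq // => x y [/val_inj].
- by rewrite size_takel // size_map -cardE.
- by move=> v /mem_take /mapP[x]; rewrite mem_enum inE => hx ->; split; first exact: h.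
Qed.

Lemma gspans_spans p q (A : point -> Prop) :
  (forall u, Z u -> in_rect p q u) ->
  gspans z (restrict (p := p) (q := q) A) -> spans Z A.
Proof.
move=> hZ hA.
pose U (x : 'I_p) (y : 'I_q) := `[< exists t, iterT Z t A (val x, val y) >].
(* The grid is finite, so the maximum of the individual times serves all its points. *)
have [t ht] : exists t, forall x y, U x y -> iterT Z t A (val x, val y).
  have /choice[f hf] : forall u : 'I_p * 'I_q, exists t,
      U u.1 u.2 -> iterT Z t A (val u.1, val u.2).
    move=> u; have [/asboolP[t ht]|hn] := boolP (U u.1 u.2); last by exists 0.
    by exists t.
  exists (\max_u f u) => x y /(hf (x, y)); apply: iterT_mono.
  exact: (leq_bigmax (x, y)).
have hU x y : U x y.
  apply: hA => [{}x {}y /asboolP h|{}x {}y hz]; first by apply/asboolP; exists 0.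
  apply/asboolP; exists t.+1; apply: T_gain => r c hrc.
  have [hr|hr] := ltnP r (row U y).
    by left; apply: row_geI hr => x1; apply: ht.
  have [hc|hc] := ltnP c (col U x).
    by right; apply: col_geI hc => x1; apply: ht.
  by case/negP: hz; apply/asboolP; apply: Z_down hrc.
(* With [p] points on it, each row meeting the grid fills in one step; then every column has [q]
   points and the plane fills in the next. *)
have hrow u : u.2 < q -> iterT Z t.+1 A u.
  move=> hu; apply: T_gain => r c /hZ[/= hr _]; left.
  apply: (@row_geI p predT) => [x _|]; last by rewrite cardsT card_ord.
  exact: (ht x (Ordinal hu)).
move=> u; exists t.+2; apply: T_gain => r c /hZ[/= _ hc]; right.
apply: (@col_geI q predT) => [y _|]; last by rewrite cardsT card_ord.
by apply: (hrow (u.1, val y)) => /=.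
Qed.

End Plane.

(** * Lists of points as grids, and the theorem *)

Definition grid_seq p q (B : 'I_p -> 'I_q -> bool) : seq point :=
  [seq (val u.1, val u.2) | u <- enum [set u : 'I_p * 'I_q | B u.1 u.2]].

Lemma grid_inj p q : injective (fun u : 'I_p * 'I_q => (val u.1, val u.2)).
Proof. by move=> [x y] [x' y'] [/val_inj-> /val_inj->]. Qed.

Lemma mem_grid_seq p q (B : 'I_p -> 'I_q -> bool) x y :
  ((val x, val y) \in grid_seq B) = B x y.
Proof.
by rewrite (mem_map (@grid_inj p q) _ (x, y)) mem_enum inE.
Qed.

Lemma ncard_grid_seq p q (B : 'I_p -> 'I_q -> bool) : ncard (grid_seq B) = gsize B.
Proof.
rewrite /ncard undup_id; first by rewrite size_map -cardE gsize_card.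
by rewrite map_inj_uniq ?enum_uniq //; apply: grid_inj.
Qed.

Lemma gsize_restrict p q (A : seq point) :
  gsize (restrict (p := p) (q := q) (setof A)) <= ncard A.
Proof.
rewrite -ncard_grid_seq; apply: uniq_leq_size; first exact: undup_uniq.
move=> v; rewrite !mem_undup => /mapP[u]; rewrite mem_enum inE => /asboolP h ->.
exact: h.
Qed.

Lemma seq_in_rect (A : seq point) a b :
  exists p q, [/\ a <= p, b <= q & forall u, u \in A -> in_rect p q u].
Proof.
exists (maxn a (\max_(u <- A) u.1).+1), (maxn b (\max_(u <- A) u.2).+1).
split; rewrite ?leq_maxl // => u hu; split; rewrite leq_max ltnS.
  by rewrite (leq_bigmax_seq u (F := fst)) ?orbT.
by rewrite (leq_bigmax_seq u (F := snd)) ?orbT.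
Qed.

Lemma zero_set_down Z : is_zero_set Z ->
  forall r c r' c', r' <= r -> c' <= c -> Z (r, c) -> Z (r', c').
Proof.
move=> [F hF] r c r' c' hr hc /hF[a [b [h1 h2 h3 [/= h4 h5]]]].
by apply/hF; exists a, b; split=> //; split; [apply: leq_ltn_trans h4|apply: leq_ltn_trans h5].
Qed.

(** Columns are cut down to [a], then, after a transposition, rows to [b]. *)
Lemma spans_in_rect (Z : point -> Prop) a b (A : seq point) :
  is_zero_set Z -> (forall u, Z u -> in_rect a b u) -> spans Z (setof A) ->
  exists B : seq point,
    [/\ forall u, u \in B -> in_rect a b u, spans Z (setof B) & ncard B <= ncard A].
Proof.
move=> /zero_set_down Zd hZ hA.
have [p [q [hp hq hpq]]] := seq_in_rect A a b.
have hG := spans_gspans Zd hpq hA.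
have [|r c /asboolP/hZ[]//|B hB1 /gspans_tr hB2] := remove_columns (a := a) _ _ hp hG.
  by move=> r c r' c' hr hc /asboolP h; apply/asboolP; apply: Zd h.
have [|r c /asboolP/hZ[]//|C hC1 /gspans_tr hC2] := remove_columns (a := b) _ _ hq hB2.
  by move=> r c r' c' hr hc /asboolP h; apply/asboolP; apply: Zd h.
exists (grid_seq (fun x y => C y x)); split.
- by move=> _ /mapP[[x y] _ ->]; split=> /=.
- apply: (gspans_spans Zd hZ) => S hS; apply: hC2 => x y h.
  by apply: hS; apply/asboolP; rewrite /setof mem_grid_seq.
- rewrite ncard_grid_seq gsize_tr (leq_trans hC1) // gsize_tr (leq_trans hB1) //.
  exact: gsize_restrict.
Qed.

Theorem mainTheorem2 (Z : point -> Prop) (a0 b0 : nat) :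
  is_zero_set Z -> finite_set Z -> 0 < a0 -> 0 < b0 ->
  (forall p, Z p -> in_rect a0 b0 p) ->
  (* gamma(Z) = min { |A| : A subset of R_{a0,b0}, A finite and spans } *)
  (forall n : nat,
     is_min (fun m => exists A : seq point, spans Z (setof A) /\ ncard A = m) n <->
     is_min (fun m => exists A : seq point,
                [/\ forall p, p \in A -> in_rect a0 b0 p,
                    spans Z (setof A) & ncard A = m]) n) /\
  (* equivalent form *)
  (forall A : seq point, spans Z (setof A) ->
     exists B : seq point,
       [/\ forall p, p \in B -> in_rect a0 b0 p, spans Z (setof B) & ncard B <= ncard A]).
Proof.
move=> hz _ _ _ hZ; have main A := spans_in_rect (A := A) hz hZ.
split=> // n; split=> -[].
  move=> [A [hA <-]] hmin; have [B [h1 h2 h3]] := main A hA.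
  split=> [|_ [C [_ hC <-]]]; last by apply: hmin; exists C.
  (* Minimality of [A] forces equality of the two sizes. *)
  exists B; split=> //; apply/eqP; rewrite eqn_leq h3 /=.
  by apply: hmin; exists B.
move=> [A [h1 h2 <-]] hmin; split=> [|_ [C [/main[B [h3 h4 h5]] <-]]]; first by exists A.
by apply: leq_trans h5; apply: hmin; exists B.
Qed.
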